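(* Let $\{V_n\}_{n\ge 0}$ be the Fennessey-Larcombe-French sequence, defined by $V_0=1$, $V_1=8$ and, for $n\ge 2$, $$(n-1)n^2 V_n = 8(n-1)(3n^2-n-1)V_{n-1} - 128(n-2)n^2 V_{n-2}.$$ Then $\{V_n\}_{n\ge 1}$ is ratio log-convex, that is, for all integers $n\ge 3$, $$\left(\frac{V_n}{V_{n-1}}\right)^2 \le \frac{V_{n-1}}{V_{n-2}}\cdot\frac{V_{n+1}}{V_n}.$$
   Context: A real sequence $\{S_n\}$ is called ratio log-convex if the sequence of ratios $\{S_n/S_{n-1}\}$ is log-convex, i.e. $(S_n/S_{n-1})^2 \le (S_{n-1}/S_{n-2})(S_{n+1}/S_n)$. *)

(* Defs.v *)
From mathcomp Require Import all_boot all_order all_algebra.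

Set Implicit Arguments.
Unset Strict Implicit.
Unset Printing Implicit Defensive.

Import Order.TTheory GRing.Theory Num.Theory.
Local Open Scope ring_scope.

(* The leading coefficient (n - 1) n^2 is nonzero for n >= 2, so in any real
   field exactly one sequence, with rational values, has this property. *)
Definition is_FLF (R : realFieldType) (V : nat -> R) : Prop :=
  [/\ V 0%N = 1,
      V 1%N = 8 &
      forall n : nat, (2 <= n)%N ->
        (n%:R - 1) * n%:R ^+ 2 * V n =
          8 * (n%:R - 1) * (3 * n%:R ^+ 2 - n%:R - 1) * V (n - 1)%N
          - 128 * (n%:R - 2) * n%:R ^+ 2 * V (n - 2)%N].

(* {u_n}_{n >= m} is log-convex; values of u below m are not constrained. *)
Definition log_convex_from (R : realFieldType) (m : nat) (u : nat -> R) : Prop :=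
  forall n : nat, (m + 1 <= n)%N -> u n ^+ 2 <= u (n - 1)%N * u (n + 1)%N.

(* The ratios S_n / S_{n-1} of {S_n}_{n >= m} are indexed by n >= m + 1. *)
Definition ratio_log_convex_from (R : realFieldType) (m : nat) (S : nat -> R) :
    Prop :=
  log_convex_from (m + 1) (fun n => S n / S (n - 1)%N).

(* Main.v *)
Require Import Defs.
From mathcomp Require Import all_boot all_order all_algebra.
From mathcomp Require Import ring lra.
Import Order.TTheory GRing.Theory Num.Theory.
Local Open Scope ring_scope.

(** Put r_n = V_n / V_{n-1}.  The recurrence reads r_{n+1} = a_{n+1} - b_{n+1} / r_n,
    an increasing function of r_n, and the bound r_n >= 16 (1 + (n + 3) / n^4)
    propagates along it from n = 4 on.  Eliminating r_{n-1} and r_{n+1} turns the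
    claim into the nonnegativity of a quartic in t, where r_n = 16 (1 + t).  Its
    coefficients of t, ..., t^4 are nonnegative and only the constant one is
    negative, so the lower bound t >= (n + 3) / n^4 decides it.  The bound fails
    at n = 3, where the inequality is checked on the values. *)

Ltac nonneg :=
  repeat first [assumption | exact: ler0n | exact: ler01
               | apply: addr_ge0 | apply: mulr_ge0 | apply: exprn_ge0].

Section RealInequalities.

Variable R : realFieldType.
Implicit Types x t A B C D : R.

(** The constant term in t is -(x^2 + 6x + 2). With [c1] the coefficient of t, c1 (x + 3) and x^4
    (x^2 + 6x + 2) agree in their two leading terms, which singles out the 3 in x + 3, and the
    remainder is nonnegative. *)
Lemma quartic_ge0 x t : 4 <= x -> x + 3 <= x ^+ 4 * t ->
  0 <= (x - 2) * x ^+ 2 * (3 * x ^+ 2 + 5 * x + 1) * (1 + t)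
       - (x - 2) * x * (x - 1) * (x + 1) ^+ 2
       - (x - 1) * (x + 1) ^+ 2 * (2 * (3 * x ^+ 2 - x - 1) * (1 + t) ^+ 3
                                   - 4 * x ^+ 2 * (1 + t) ^+ 4).
Proof.
move=> x_ge4 ht.
have x_gt0 : 0 < x by lra.
have x_ge0 : 0 <= x by lra.
have x1_ge0 : 0 <= x - 1 by lra.
have x2_ge0 : 0 <= x - 2 by lra.
have x4_gt0 : 0 < x ^+ 4 by exact: exprn_gt0.
have t_ge0 : 0 <= t by rewrite -(pmulr_rge0 _ x4_gt0); apply: le_trans ht; lra.
have ht0 : 0 <= x ^+ 4 * t - (x + 3) by rewrite subr_ge0.
rewrite -(pmulr_rge0 _ x4_gt0).
set c1 := x ^+ 5 + 3 * x ^+ 4 + 5 * x * (x - 2) * (x + 2) + 8 * (x - 1) + 2.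
(* Subtractions are grouped into x - 1, x - 2 and the slack [ht0], whose signs [nonneg] finds among
   the hypotheses. *)
rewrite [leRHS](_ : _ =
    (12 * x ^+ 2 * (x - 1) * (x + 1) + 15 * x * (x - 2) * (x + 2) + 18 * (x - 1))
    + c1 * (x ^+ 4 * t - (x + 3))
    + x ^+ 4 * (x - 1) * (x + 1) ^+ 2 * (6 * (x ^+ 2 + x + 1) * t ^+ 2
        + 2 * (5 * x ^+ 2 + x + 1) * t ^+ 3 + 4 * x ^+ 2 * t ^+ 4)); first last.
  by rewrite /c1; ring.
by rewrite /c1; nonneg.
Qed.

(** B, C, D stand for V_{n-1}, V_n, V_{n+1} at n = x. B enters the recurrence with a negative
    coefficient, so an upper bound of B by C bounds D below by a multiple of C. *)
Lemma ratio_bound_step x B C D : 4 <= x -> 0 < B ->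
  x * (x + 1) ^+ 2 * D =
    8 * x * (3 * x ^+ 2 + 5 * x + 1) * C - 128 * (x - 1) * (x + 1) ^+ 2 * B ->
  16 * (x ^+ 4 + x + 3) * B <= x ^+ 4 * C ->
  0 < C /\ 16 * ((x + 1) ^+ 4 + (x + 1) + 3) * C <= (x + 1) ^+ 4 * D.
Proof.
move=> x_ge4 B_gt0 recD hC.
have x_gt0 : 0 < x by lra.
have x_ge0 : 0 <= x by lra.
have x1_ge0 : 0 <= x - 1 by lra.
have x2_ge0 : 0 <= x - 2 by lra.
have x4_gt0 : 0 < x ^+ 4 by exact: exprn_gt0.
have q_gt0 : 0 < x ^+ 4 + x + 3 by lra.
have C_gt0 : 0 < C.
  rewrite -(pmulr_rgt0 _ x4_gt0); apply: lt_le_trans hC.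
  by rewrite !mulr_gt0.
split=> //; have C_ge0 := ltW C_gt0.
have hC0 : 0 <= x ^+ 4 * C - 16 * (x ^+ 4 + x + 3) * B by rewrite subr_ge0.
(* This factor lets D be replaced through [recD], and then B be absorbed into the slack [hC0],
   without division. *)
rewrite -subr_ge0 -(pmulr_rge0 _ (mulr_gt0 x_gt0 q_gt0)).
rewrite [leRHS](_ : _ = (x + 1) ^+ 2 * (x ^+ 4 + x + 3) * (x * (x + 1) ^+ 2 * D)
   - 16 * x * (x ^+ 4 + x + 3) * ((x + 1) ^+ 4 + (x + 1) + 3) * C); last by ring.
rewrite recD [leRHS](_ : _ =
    8 * (x + 1) ^+ 4 * (x - 1) * (x ^+ 4 * C - 16 * (x ^+ 4 + x + 3) * B)
    + 8 * x * C * (12 * x * (x - 2) * (x + 2) + 3 * x ^+ 2 + 30 * (x - 1) + 3));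
  last by ring.
by nonneg.
Qed.

(** With A, ..., D = V_{n-2}, ..., V_{n+1}, this is r_n^2 <= r_{n-1} r_{n+1} cleared of
    denominators. *)
Lemma cubes_le_of_ratio_bound x A B C D : 4 <= x -> 0 < B ->
  (x - 1) * x ^+ 2 * C =
    8 * (x - 1) * (3 * x ^+ 2 - x - 1) * B - 128 * (x - 2) * x ^+ 2 * A ->
  x * (x + 1) ^+ 2 * D =
    8 * x * (3 * x ^+ 2 + 5 * x + 1) * C - 128 * (x - 1) * (x + 1) ^+ 2 * B ->
  16 * (x ^+ 4 + x + 3) * B <= x ^+ 4 * C ->
  A * C ^+ 3 <= B ^+ 3 * D.
Proof.
move=> x_ge4 B_gt0 recC recD hC.
have x_gt0 : 0 < x by lra.
have x1_gt0 : 0 < x + 1 by lra.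
have x2_gt0 : 0 < x - 2 by lra.
(* 16 is the larger root of r^2 = 24 r - 128, the limiting form of the recurrence. *)
pose t := C / (16 * B) - 1.
have B_neq0 : B != 0 by rewrite gt_eqF.
have defC : C = 16 * (1 + t) * B by rewrite /t; field.
have ht : x + 3 <= x ^+ 4 * t.
  have B16_gt0 : 0 < 16 * B by rewrite mulr_gt0.
  rewrite -(ler_pM2r B16_gt0) -subr_ge0.
  rewrite [leRHS](_ : _ = x ^+ 4 * (16 * (1 + t) * B) - 16 * (x ^+ 4 + x + 3) * B);
    last by ring.
  by rewrite -defC subr_ge0.
(* The product of the coefficients of A and D in the two recurrences, so that both can be eliminated
   by rewriting. *)
have K_gt0 : 0 < 128 * (x - 2) * x ^+ 2 * (x * (x + 1) ^+ 2).
  by rewrite !mulr_gt0 ?exprn_gt0.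
rewrite -subr_ge0 -(pmulr_rge0 _ K_gt0).
have recA : 128 * (x - 2) * x ^+ 2 * A =
    8 * (x - 1) * (3 * x ^+ 2 - x - 1) * B - (x - 1) * x ^+ 2 * C.
  by rewrite recC; ring.
rewrite [leRHS](_ : _ =
    128 * (x - 2) * x ^+ 2 * B ^+ 3 * (x * (x + 1) ^+ 2 * D)
    - x * (x + 1) ^+ 2 * C ^+ 3 * (128 * (x - 2) * x ^+ 2 * A)); last by ring.
rewrite recA recD defC [leRHS](_ : _ = 128 * 128 * B ^+ 4 * x *
  ((x - 2) * x ^+ 2 * (3 * x ^+ 2 + 5 * x + 1) * (1 + t)
       - (x - 2) * x * (x - 1) * (x + 1) ^+ 2
       - (x - 1) * (x + 1) ^+ 2 * (2 * (3 * x ^+ 2 - x - 1) * (1 + t) ^+ 3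
                                   - 4 * x ^+ 2 * (1 + t) ^+ 4))); last by ring.
apply: mulr_ge0 (quartic_ge0 _ _ x_ge4 ht).
by rewrite !mulr_ge0 ?exprn_ge0 // ltW.
Qed.

End RealInequalities.

Section FennesseyLarcombeFrench.

Variables (R : realFieldType) (V : nat -> R).
Hypothesis hV : is_FLF V.

Lemma FLF_rec (n : nat) : (1 <= n)%N -> let x : R := n%:R in
  x * (x + 1) ^+ 2 * V n.+1 =
    8 * x * (3 * x ^+ 2 + 5 * x + 1) * V n - 128 * (x - 1) * (x + 1) ^+ 2 * V n.-1.
Proof.
case: n => // n _ x; have [_ _ /(_ n.+2 isT)] := hV.
rewrite subSS subn0 subSS subn1 /= -[n.+2%:R]natr1 -/x addrK => recV.
by rewrite recV; ring.
Qed.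

Lemma FLF_values : [/\ V 1 = 8, V 2 = 144, V 3 = 2432 & V 4 = 200 ^+ 2].
Proof.
have [_ V1 _] := hV.
have /= V2 := FLF_rec 1 isT; have /= V3 := FLF_rec 2 isT.
have /= V4 := FLF_rec 3 isT.
have e2 : V 2 = 144 by lra.
have e3 : V 3 = 2432 by lra.
by split=> //; lra.
Qed.

Lemma FLF_ratio_bound (n : nat) : (4 <= n)%N -> let x : R := n%:R in
  0 < V n.-1 /\ 16 * (x ^+ 4 + x + 3) * V n.-1 <= x ^+ 4 * V n.
Proof.
elim: n => // n IHn; rewrite leq_eqVlt ltnS => /predU1P[<- | n_ge4] x.
  (* The base case is tight: 10233856 <= 10240000. *)
  by have [_ _ V3 V4] := FLF_values; rewrite /x /= V3 V4; split; lra.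
have [Vn1_gt0 bnd] := IHn n_ge4.
rewrite /x -[n.+1%:R]natr1 /=; apply: ratio_bound_step Vn1_gt0 _ bnd.
  by rewrite ler_nat.
by apply: FLF_rec; apply: leq_trans n_ge4.
Qed.

Lemma FLF_gt0 (n : nat) : (1 <= n)%N -> 0 < V n.
Proof.
have [V1 V2 _ _] := FLF_values.
case: n => [|[|[|n]]] // _; [by rewrite V1 | by rewrite V2 |].
(* The bound at index n + 4 carries the positivity of V at n + 3. *)
by have [] := FLF_ratio_bound n.+4 isT.
Qed.

Lemma FLF_cubes (n : nat) : (3 <= n)%N ->
  V n.-2 * V n ^+ 3 <= V n.-1 ^+ 3 * V n.+1.
Proof.
rewrite leq_eqVlt => /predU1P[<- | n_ge4] /=.
  have [-> -> -> ->] := FLF_values; lra.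
have [Vn1_gt0 bnd] := FLF_ratio_bound n n_ge4.
apply: (cubes_le_of_ratio_bound _ n%:R _ _ _ _ _ Vn1_gt0 _ _ bnd).
- by rewrite ler_nat.
- have [_ _ /(_ n)] := hV; rewrite subn1 subn2; apply.
  by apply: leq_trans n_ge4.
- by apply: FLF_rec; apply: leq_trans n_ge4.
Qed.

End FennesseyLarcombeFrench.

Theorem theorem1p3 (R : realFieldType) (V : nat -> R) (hV : is_FLF V) :
  ratio_log_convex_from 1 V /\
  (forall n : nat, (3 <= n)%N ->
     (V n / V (n - 1)%N) ^+ 2 <=
       (V (n - 1)%N / V (n - 2)%N) * (V (n + 1)%N / V n)).
Proof.
have main (n : nat) : (3 <= n)%N ->
    (V n / V (n - 1)%N) ^+ 2 <=
      (V (n - 1)%N / V (n - 2)%N) * (V (n + 1)%N / V n).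
  case: n => [|[|[|n]]] // _.
  rewrite subn1 subn2 addn1 /=; have := FLF_cubes R V hV n.+3 isT => /=.
  have := FLF_gt0 R V hV n.+1 isT; have := FLF_gt0 R V hV n.+2 isT.
  have := FLF_gt0 R V hV n.+3 isT.
  move: (V n.+1) (V n.+2) (V n.+3) (V n.+4) => A B C D C_gt0 B_gt0 A_gt0 hcubes.
  (* The common denominator of both sides; multiplying by it leaves exactly [hcubes]. *)
  have K_gt0 : 0 < A * B ^+ 2 * C by rewrite !mulr_gt0 ?exprn_gt0.
  rewrite -(ler_pM2r K_gt0).
  have [A0 B0 C0] : [/\ A != 0, B != 0 & C != 0] by rewrite !gt_eqF.
  rewrite [leLHS](_ : _ = A * C ^+ 3); last by field.
  by rewrite [leRHS](_ : _ = B ^+ 3 * D) //; field; rewrite A0 C0.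
split=> // n n_ge3; have := main n n_ge3.
by rewrite addnK -subnDA addn1.
Qed.
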